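(* Let $(X,d)$ be a complete $b$-metric space with constant $s\in[1,\infty)$ and let $T:X\to\mathcal{B}(X)$ be a function such that: (i) $T$ is continuous; (ii) there exist $c,\delta\in[0,1]$ and $\alpha\in[0,1)$ such that $h(T(x),T(y))\le\alpha N_{c,\delta}(x,y)$ for all $x,y\in X$; (iii) $\alpha\delta s<1$ (for the constants $\alpha,\delta$ of (ii)). Then $T$ has a fixed point, i.e. there exists $u\in X$ with $u\in T(u)$.
   Context: Given a nonempty set $X$ and a real number $s\in[1,\infty)$, a function $d:X\times X\to[0,\infty)$ is called a $b$-metric (with constant $s$) if for all $x,y,z\in X$: (i) $d(x,y)=0$ if and only if $x=y$; (ii) $d(x,y)=d(y,x)$; (iii) $d(x,y)\le s(d(x,z)+d(z,y))$. The pair $(X,d)$ is called a $b$-metric space. A sequence $(x_n)_{n\in\mathbb{N}}$ in $X$ is convergent to $l\in X$ (written $\lim_{n\to\infty}x_n=l$) if $\lim_{n\to\infty}d(x_n,l)=0$; it is Cauchy if for every $\varepsilon>0$ there exists $n_\varepsilon\in\mathbb{N}$ such that $d(x_m,x_n)<\varepsilon$ for all $m,n\ge n_\varepsilon$. $(X,d)$ is complete if every Cauchy sequence is convergent. The space carries the topology induced by this convergence: a subset is closed if it contains the limit of each convergent sequence of its elements. $\mathcal{B}(X)$ denotes the set of non-empty bounded closed subsets of $X$ (bounded meaning that $d$ is bounded on pairs of elements of the subset). For $x\in X$ and $C\in\mathcal{B}(X)$, $d(x,C)=\inf_{c\in C}d(x,c)$. For $A,B\in\mathcal{B}(X)$,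 $h(A,B)=\max\{\sup_{a\in A}d(a,B),\ \sup_{b\in B}d(b,A)\}$. For constants $c,\delta\in[0,1]$ and $x,y\in X$, $$N_{c,\delta}(x,y)=\max\Big\{d(x,y),\ c\,d(x,T(x)),\ c\,d(y,T(y)),\ \tfrac{\delta}{2}\big(d(x,T(y))+d(y,T(x))\big)\Big\}.$$ A function $T:X\to\mathcal{B}(X)$ is called continuous if for all sequences $(x_n)_{n\in\mathbb{N}}$, $(y_n)_{n\in\mathbb{N}}$ in $X$ and all $x,y\in X$ such that $\lim_{n\to\infty}x_n=x$, $\lim_{n\to\infty}y_n=y$ and $y_n\in T(x_n)$ for every $n\in\mathbb{N}$, one has $y\in T(x)$. *)

(* Defs.v *)
From mathcomp Require Import all_boot all_order all_algebra.
From mathcomp Require Import boolp classical_sets functions reals.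
From mathcomp Require Import topology normedtype sequences.

Set Implicit Arguments.
Unset Strict Implicit.
Unset Printing Implicit Defensive.

Import Order.TTheory GRing.Theory Num.Theory.
Import numFieldNormedType.Exports.

Local Open Scope classical_set_scope.
Local Open Scope ring_scope.

Section BMetric.
Variables (R : realType) (X : Type).

Record is_bmetric (s : R) (d : X -> X -> R) : Prop := IsBMetric {
  bmetric_s_ge1 : 1 <= s ;
  bmetric_ge0 : forall x y, 0 <= d x y ;
  bmetric_eq0 : forall x y, d x y = 0 <-> x = y ;
  bmetric_sym : forall x y, d x y = d y x ;
  bmetric_triangle : forall x y z, d x y <= s * (d x z + d z y)
}.

Variable d : X -> X -> R.

Definition bconverges (u : nat -> X) (l : X) : Prop :=
  (fun n => d (u n) l) @ \oo --> (0 : R).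

Definition bcauchy (u : nat -> X) : Prop :=
  forall eps : R, 0 < eps ->
    exists N : nat, forall m n : nat, (N <= m)%N -> (N <= n)%N ->
      d (u m) (u n) < eps.

Definition bcomplete : Prop :=
  forall u : nat -> X, bcauchy u -> exists l : X, bconverges u l.

Definition bclosed (A : set X) : Prop :=
  forall (u : nat -> X) (l : X),
    (forall n, A (u n)) -> bconverges u l -> A l.

Definition bbounded (A : set X) : Prop :=
  exists M : R, forall x y, A x -> A y -> d x y <= M.

(* The family of nonempty bounded closed subsets. For a b-metric d, the real
   infima and suprema in dist_to and hausdorff below range over nonempty
   bounded sets of reals as soon as their set arguments are in this family. *)
Definition closed_bounded : set (set X) :=
  [set C | [/\ C !=set0, bbounded C & bclosed C]].

Definition dist_to (x : X) (C : set X) : R := inf [set d x c | c in C].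

Definition hausdorff (A B : set X) : R :=
  Num.max (sup [set dist_to a B | a in A]) (sup [set dist_to b A | b in B]).

Definition Nmax (T : X -> set X) (c delta : R) (x y : X) : R :=
  Num.max (d x y)
    (Num.max (c * dist_to x (T x))
      (Num.max (c * dist_to y (T y))
        (delta / 2 * (dist_to x (T y) + dist_to y (T x))))).

Definition mv_continuous (T : X -> set X) : Prop :=
  forall (u v : nat -> X) (x y : X),
    bconverges u x -> bconverges v y -> (forall n, T (u n) (v n)) -> T x y.

End BMetric.

(* Main.v *)
Require Import Defs.
From mathcomp Require Import all_boot all_order all_algebra.
From mathcomp Require Import boolp classical_sets functions reals.
From mathcomp Require Import topology normedtype sequences.
From mathcomp Require Import lra.

Import Order.TTheory GRing.Theory Num.Theory.
Import numFieldNormedType.Exports.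

Local Open Scope classical_set_scope.
Local Open Scope ring_scope.

Set Implicit Arguments.
Unset Strict Implicit.

(** The fixed point is the limit of an orbit [x_(n+1) \in T x_n] whose steps
    decay geometrically.  Put [q = alpha * delta * s].  If [y \in T x],
    [t = d x y] and [r] is the distance from [y] to [T y], then [r] is at most
    the Hausdorff distance from [T x] to [T y], and the contraction hypothesis
    bounds it by one of [alpha * t], [alpha * r] and [q * (t + r) / 2]: the
    distance from [y] to [T x] vanishes, and a single use of the relaxed
    triangle inequality compares the distance from [x] to [T y] with [t + r].
    Each case gives [r <= Num.max alpha q * t] ([dist_to_next_le]).  The factor
    is below [1], so, at the price of a slightly larger [beta < 1], some
    [z \in T y] satisfies [d y z <= beta * t] ([next_point]), and the orbit
    can be built by dependent choice ([geometric_orbit]).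

    Summing the steps directly is not enough to make the orbit Cauchy, since
    the [j]-th step comes with a factor [s ^+ j] and [s * beta] may exceed [1].
    But a block of [m] consecutive steps only costs a constant that depends on
    [m] ([block_le]), and [s * beta ^+ m <= 1 / 2] for a large [m]; so the
    subsequence [x_(m k)] is Cauchy ([cauchy_of_small_ratio]) and has a limit
    [u].  The shifted subsequence [x_(m k + 1)] has the same limit, as the steps
    tend to [0], and its [k]-th term lies in [T x_(m k)]; continuity then gives
    [u \in T u]. *)

(** * Geometric sequences in a b-metric space *)

Section GeometricSequences.
Variables (R : realType) (X : Type) (s : R) (d : X -> X -> R).
Hypothesis d_bmetric : is_bmetric s d.

Let s1 : 1 <= s.
Proof. exact: bmetric_s_ge1 d_bmetric. Qed.
Let s0 : 0 <= s.
Proof. exact: le_trans ler01 s1. Qed.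
Let d0 x y : 0 <= d x y.
Proof. exact: bmetric_ge0 d_bmetric x y. Qed.
Let tri x y z : d x y <= s * (d x z + d z y).
Proof. exact: bmetric_triangle d_bmetric x y z. Qed.
Let dxx x : d x x = 0.
Proof. by apply/(bmetric_eq0 d_bmetric). Qed.

(** The triangle inequality, iterated over a fixed number [j] of steps, only
    costs a constant that depends on [j]. *)
Lemma block_le (x : nat -> X) (M b : R) :
  0 <= M -> 0 <= b <= 1 -> (forall n, d (x n) (x n.+1) <= M * b ^+ n) ->
  forall j, exists2 D : R, 0 <= D & forall n, d (x n) (x (n + j)%N) <= D * b ^+ n.
Proof.
move=> M0 /andP[b0 b1] hx; elim=> [|j [D D0 hD]].
  by exists 0 => // n; rewrite addn0 dxx mul0r.
exists (s * (M + D)) => [|n]; first by rewrite mulr_ge0 ?addr_ge0.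
have := tri (x n) (x (n + j.+1)%N) (x n.+1).
have := hx n; have := hD n.+1; rewrite addSnnS exprS.
have : 0 <= b ^+ n by apply: exprn_ge0.
move: (b ^+ n) (d (x n) (x n.+1)) (d (x n.+1) _) => p e f p0 fle ele.
move=> /le_trans; apply.
rewrite -mulrA ler_wpM2l// mulrDl lerD//; apply: (le_trans fle).
by rewrite ler_wpM2l// ler_piMl.
Qed.

(** When [s * g <= 1 / 2], unrolling [tri] from the first point gives a
    geometric series of ratio [s * g], with sum at most [2 * s * D * g ^+ k]. *)
Lemma tail_le (y : nat -> X) (D g : R) :
  0 <= D -> 0 <= g -> s * g <= 1 / 2 ->
  (forall k, d (y k) (y k.+1) <= D * g ^+ k) ->
  forall j k, d (y k) (y (k + j)%N) <= 2 * s * D * g ^+ k.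
Proof.
move=> D0 g0 sg hy; have s_ge1 := s1.
elim=> [|j IH] k; have p0 : 0 <= g ^+ k by apply: exprn_ge0.
  by rewrite addn0 dxx !mulr_ge0.
have := tri (y k) (y (k + j.+1)%N) (y k.+1).
have := hy k; have := IH k.+1; rewrite addSnnS exprS.
move: (g ^+ k) p0 (d (y k) (y k.+1)) (d (y k.+1) _) => p p0 e f fle ele.
move=> /le_trans; apply.
have Dp : 0 <= D * p by apply: mulr_ge0.
have -> : 2 * s * D * p = s * (2 * (D * p)) by lra.
rewrite ler_wpM2l//.
have : f <= 2 * (s * g) * (D * p) by lra.
have : (s * g) * (D * p) <= 1 / 2 * (D * p) by apply: ler_wpM2r.
lra.
Qed.

Lemma geometric_eventually_le (b e : R) : 0 <= b < 1 -> 0 < e ->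
  exists N, forall n, (N <= n)%N -> b ^+ n <= e.
Proof.
move=> /andP[b0 b1] e0.
have /cvg_expr /cvgrPdist_le /(_ _ e0) [N _ hN] : `|b| < 1 by rewrite ger0_norm.
exists N => n /hN /=; rewrite sub0r normrN ger0_norm//; exact: exprn_ge0.
Qed.

Lemma cauchy_of_small_ratio (y : nat -> X) (D g : R) :
  0 <= D -> 0 <= g -> s * g <= 1 / 2 ->
  (forall k, d (y k) (y k.+1) <= D * g ^+ k) -> bcauchy d y.
Proof.
move=> D0 g0 sg hy e e0; have s_ge1 := s1.
have sD : 0 <= s * D by nra.
have K0 : 0 < 2 * s * D + 1 by lra.
have g1 : g < 1 by nra.
(* The [+ 1] keeps the divisor positive when [D = 0]. *)
have [||N hN] := geometric_eventually_le (b := g) (e := e / 2 / (2 * s * D + 1)).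
- by rewrite g0.
- by rewrite !divr_gt0.
exists N.
have bound m n : (N <= m)%N -> (m <= n)%N -> d (y m) (y n) < e.
  move=> Nm mn; have := tail_le D0 g0 sg hy (n - m)%N m; rewrite subnKC//.
  have := hN _ Nm; rewrite ler_pdivlMr// => h1 h2.
  have : 0 <= g ^+ m by apply: exprn_ge0.
  by nra.
move=> m n Nm Nn; case: (leqP m n) => [mn|/ltnW nm]; first exact: bound.
by rewrite (bmetric_sym d_bmetric); apply: bound.
Qed.

Lemma squeeze_cvg0 (f g : nat -> R) :
  (forall n, 0 <= f n <= g n) -> g @ \oo --> (0 : R) -> f @ \oo --> (0 : R).
Proof.
move=> fg g0; apply: (squeeze_cvgr _ (cvg_cst 0) g0).
by near=> n; exact: fg.
Unshelve. all: by end_near.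
Qed.

Lemma bconverges_close (y z : nat -> X) (u : X) :
  bconverges d y u -> (fun n => d (z n) (y n)) @ \oo --> (0 : R) ->
  bconverges d z u.
Proof.
move=> yu zy.
apply: (@squeeze_cvg0 _ (fun n => s * (d (z n) (y n) + d (y n) u))) => [n|].
  by rewrite d0 tri.
rewrite -(mulr0 s); apply: cvgM; first exact: cvg_cst.
by rewrite -(addr0 0); apply: cvgD.
Qed.

(** * Distances to sets *)

Lemma dist_to_le x (A : set X) a : A a -> dist_to d x A <= d x a.
Proof.
by move=> Aa; apply: ge_inf; [exists 0 => _ [y _ <-] | exists a].
Qed.

Lemma dist_to_ge0 x (A : set X) : A !=set0 -> 0 <= dist_to d x A.
Proof. by move=> [a Aa]; apply: lb_le_inf; [exists (d x a), a | move=> _ [y _ <-]]. Qed.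

Lemma dist_to_triangle x y (A : set X) :
  A !=set0 -> dist_to d x A <= s * (d x y + dist_to d y A).
Proof.
move=> [a Aa]; have s_gt0 : 0 < s by apply: lt_le_trans ltr01 s1.
rewrite mulrC -ler_pdivrMr// -lerBlDl.
apply: lb_le_inf; first by exists (d y a), a.
move=> _ [b Ab <-]; rewrite lerBlDl ler_pdivrMr// mulrC.
exact: le_trans (dist_to_le _ Ab) (tri _ _ _).
Qed.

(** Boundedness of [A] makes the real supremum in [hausdorff] a genuine one. *)
Lemma dist_to_le_hausdorff (A B : set X) a :
  bbounded d A -> B !=set0 -> A a -> dist_to d a B <= hausdorff d A B.
Proof.
move=> [M hM] [b Bb] Aa; rewrite /hausdorff le_max; apply/orP; left.
apply: ub_le_sup; last by exists a.
exists (s * (M + d a b)) => _ [x Ax <-].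
apply: le_trans (dist_to_le _ Bb) _; apply: le_trans (tri x b a) _.
by rewrite ler_wpM2l ?lerD2r ?hM.
Qed.

(** * Orbits with geometric steps *)

Section Orbits.
Variables (T : X -> set X) (c delta alpha : R).
Hypothesis T_closed_bounded : forall x, closed_bounded d (T x).
Hypothesis c_range : 0 <= c <= 1.
Hypothesis delta_ge0 : 0 <= delta.
Hypothesis alpha_range : 0 <= alpha < 1.
Hypothesis T_contraction : forall x y : X,
  hausdorff d (T x) (T y) <= alpha * Nmax d T c delta x y.
Hypothesis alpha_delta_s : alpha * delta * s < 1.

Let T0 x : T x !=set0.
Proof. by have [] := T_closed_bounded x. Qed.

(** In the mixed case [r <= q * (t + r) / 2], having [t < r] would give
    [r < r], because [q < 1]; hence [r <= t] and the bound is [q * t]. *)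
Lemma dist_to_next_le x y : T x y ->
  dist_to d y (T y) <= Num.max alpha (alpha * delta * s) * d x y.
Proof.
move=> Txy; have [_ bT _] := T_closed_bounded x.
have := le_trans (dist_to_le_hausdorff bT (T0 y) Txy) (T_contraction x y).
have dy0 : dist_to d y (T x) = 0.
  by apply/eqP; rewrite eq_le dist_to_ge0// andbT -(dxx y) dist_to_le.
have dx := dist_to_le x Txy.
have dxT := dist_to_triangle x y (T0 y).
have r0 := dist_to_ge0 y (T0 y).
have dx0 := dist_to_ge0 x (T0 x).
rewrite /Nmax dy0 addr0; have := d0 x y.
move: (dist_to d y (T y)) (dist_to d x (T y)) (dist_to d x (T x)) (d x y)
  r0 dx0 dxT dx => r w v t r0 v0 ws vt t0.
have [/andP[a0 a1] /andP[c0 c1]] := (alpha_range, c_range).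
have at_le : alpha * t <= Num.max alpha (alpha * delta * s) * t.
  by rewrite ler_wpM2r// le_max lexx.
have qt_le : alpha * delta * s * t <= Num.max alpha (alpha * delta * s) * t.
  by rewrite ler_wpM2r// le_max lexx orbT.
have q0 : 0 <= alpha * delta * s by rewrite !mulr_ge0.
rewrite !maxr_pMr// !le_max => /or4P[h|h|h|h].
- exact: le_trans h at_le.
- by apply: le_trans at_le; apply: (le_trans h); rewrite ler_wpM2l//; nra.
- suff -> : r = 0 by apply: le_trans at_le; apply: mulr_ge0.
  have : alpha * (c * r) <= alpha * r by rewrite ler_wpM2l//; nra.
  by nra.
- apply: le_trans qt_le.
  have : r <= alpha * delta * s * ((t + r) / 2).
    apply: (le_trans h).
    have : alpha * delta * w <= alpha * delta * (s * (t + r)).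
      by rewrite ler_wpM2l// mulr_ge0.
    lra.
  move: (alpha * delta * s) q0 alpha_delta_s => q q0 q1 hr.
  have [rt|tr] := leP r t; first by nra.
  by nra.
Qed.

(** If [d x y = 0] then [x = y] and the point [y] itself can be repeated;
    otherwise there is room between the infimum and [b * d x y]. *)
Lemma next_point b x y : Num.max alpha (alpha * delta * s) < b -> T x y ->
  exists z, T y z /\ d y z <= b * d x y.
Proof.
move=> hb Txy; have [t0|t0] := eqVneq (d x y) 0.
  have xy : x = y by apply/(bmetric_eq0 d_bmetric).
  by exists y; rewrite -{1}xy t0 dxx mulr0.
have tpos : 0 < d x y by rewrite lt_def t0 d0.
have lt_r : dist_to d y (T y) < b * d x y.
  by apply: le_lt_trans (dist_to_next_le Txy) _; rewrite ltr_pM2r.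
have [z0 Tz0] := T0 y.
have [|_ [z Tz <-] lz] := inf_lt _ lt_r; first by exists (d y z0), z0.
by exists z; split=> //; exact: ltW.
Qed.

(** Dependent choice runs over pairs [(x, y)] with [y \in T x], since the
    choice of the next point depends on the last two. *)
Lemma geometric_orbit b (x0 : X) : Num.max alpha (alpha * delta * s) < b ->
  exists2 x : nat -> X, (forall n, T (x n) (x n.+1)) &
    forall n, d (x n) (x n.+1) <= d (x 0%N) (x 1%N) * b ^+ n.
Proof.
move=> hb; have [x1 Tx1] := T0 x0.
pose pairs := {p : X * X | T p.1 p.2}.
pose step (p q : pairs) := (sval q).1 = (sval p).2 /\
  d (sval q).1 (sval q).2 <= b * d (sval p).1 (sval p).2.
have next (p : pairs) : {q | step p q}.
  case: p => -[x y] /= Txy; apply/cid.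
  by have [z [Tyz dyz]] := next_point hb Txy; exists (exist _ (y, z) Tyz).
have [p [_ hp]] := dependent_choice next (exist _ (x0, x1) Tx1).
pose x n := (sval (p n)).1.
have xS n : x n.+1 = (sval (p n)).2 by have [] := hp n.
have b0 : 0 <= b by have /andP[] := alpha_range; rewrite gt_max in hb; case/andP: hb; lra.
exists x => n; first by rewrite xS; exact: (svalP (p n)).
elim: n => [|n IH]; first by rewrite expr0 mulr1.
have [_] := hp n; rewrite -[(sval (p n.+1)).2]xS -[(sval (p n)).2]xS => h.
by apply: (le_trans h); rewrite exprS mulrCA ler_wpM2l.
Qed.

End Orbits.
End GeometricSequences.

(** * The fixed point *)

Unset Implicit Arguments.

Theorem theorem3p1 (R : realType) (X : Type) (s : R) (d : X -> X -> R)
    (T : X -> set X) (c delta alpha : R)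
    (X_nonempty : [set: X] !=set0)
    (d_bmetric : is_bmetric s d)
    (d_complete : bcomplete d)
    (T_closed_bounded : forall x : X, closed_bounded d (T x))
    (T_continuous : mv_continuous d T)
    (c_range : 0 <= c <= 1)
    (delta_range : 0 <= delta <= 1)
    (alpha_range : 0 <= alpha < 1)
    (T_contraction : forall x y : X,
       hausdorff d (T x) (T y) <= alpha * Nmax d T c delta x y)
    (alpha_delta_s : alpha * delta * s < 1) :
  exists u : X, T u u.
Proof.
have [x0 _] := X_nonempty.
have [/andP[a0 a1] /andP[delta0 _]] := (alpha_range, delta_range).
have s1 := bmetric_s_ge1 d_bmetric.
have [b lt_b b1] : exists2 b : R, Num.max alpha (alpha * delta * s) < b & b < 1.
  have : Num.max alpha (alpha * delta * s) < 1 by rewrite gt_max a1.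
  by move: (Num.max _ _) => k k1; exists ((k + 1) / 2); lra.
have b0 : 0 <= b by apply: le_trans (ltW lt_b); rewrite le_max a0.
have [x Tx dx] := geometric_orbit d_bmetric T_closed_bounded c_range
  delta0 alpha_range T_contraction alpha_delta_s x0 lt_b.
have [m hm] : exists m, s * b ^+ m <= 1 / 2.
  have [||m hm] := geometric_eventually_le (b := b) (e := 1 / 2 / s).
  - by rewrite b0.
  - by rewrite divr_gt0//; lra.
  by exists m; rewrite mulrC -ler_pdivlMr ?hm//; lra.
have b01 : 0 <= b <= 1 by rewrite b0 ltW.
have [D D0 hD] := block_le d_bmetric (bmetric_ge0 d_bmetric _ _) b01 dx m.
pose y k := x (m * k)%N.
have cy : bcauchy d y.
  apply: (cauchy_of_small_ratio d_bmetric D0 (exprn_ge0 m b0) hm) => k.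
  by rewrite /y mulnS addnC -exprM.
have [u yu] := d_complete y cy.
exists u; apply: (T_continuous y (fun k => x (m * k).+1)) => // [|k]; last exact: Tx.
(* Steps along the subsequence vanish, because [b ^+ m <= s * b ^+ m <= 1 / 2]. *)
apply: (bconverges_close d_bmetric yu).
have bm0 : 0 <= b ^+ m by apply: exprn_ge0.
have bm1 : `|b ^+ m| < 1 by rewrite ger0_norm//; nra.
apply: (@squeeze_cvg0 _ _ (fun k => d (x 0%N) (x 1%N) * (b ^+ m) ^+ k)) => [k|].
  rewrite (bmetric_ge0 d_bmetric) (bmetric_sym d_bmetric) -exprM; exact: dx.
rewrite -(mulr0 (d (x 0%N) (x 1%N))).
by apply: cvgM; [exact: cvg_cst | exact: cvg_expr].
Qed.
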